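(* (i) Given a path $Q$ and events $a,b\notin Q$, each of which can be joined to $Q$ by some path, there are events $y,z\in Q$ such that $[y\;Q(a,\emptyset)\;z]$ and $[y\;Q(b,\emptyset)\;z]$. (ii) Given a path $Q$, events $a,b\notin Q$ each of which can be joined to $Q$ by some path, and distinct events $c,d\in Q$, there is an event $e\in Q$ and paths $ae$, $be$ such that $[c\;d\;e]$. (iii) Given two distinct paths $Q$ and $R$ which meet at an event $x$, an event $a\in R\setminus\{x\}$ and an event $b\notin Q$ which can be joined to $Q$ by some path, there is an event $e$ and paths $ae$, $be$ such that $[x\;Q(a,\emptyset)\;e]$.
   Context: Let $\mathcal E$ be a set, whose elements are called events; let $\mathcal P$ be a set of subsets of $\mathcal E$, whose elements are called paths; and let $[\,\cdot\;\cdot\;\cdot\,]$ be a ternary relation (betweenness) on $\mathcal E$. Definitions. For events $y,z$ and a set $A$ of events, $[y\;A\;z]$ means $[y\;x\;z]$ for all $x\in A$. An event $a\notin Q$ can be joined to a path $Q$ if some path contains $a$ and an event of $Q$. ''A path $ae$'' means that $a\ne e$ and there is a path containing $a$ and $e$. A finite chain is a sequence $(q_0,\dots,q_n)$ of events, $n\ge1$, such that: if $n=1$, then $q_0\ne q_1$ and some path contains both; if $n\ge2$, then $[q_i\;q_j\;q_k]$ for all $0\le i<j<k\le n$. An infinite chain is a sequence $(q_i)_{i\in\mathbb N}$ of events with $[q_i\;q_j\;q_k]$ for all $i<j<k$. A bound of an infinite chain is an event $q$ with $[q_i\;q_j\;q]$ for all $i<j$; a closest bound is a bound $q$ such that $[q_0\;q\;q']$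 for every bound $q'\ne q$. For a path $Q$ and an event $b\notin Q$, the unreachable subset of $Q$ from $b$ is $Q(b,\emptyset)=\{x\in Q:\text{ no path contains both } b \text{ and } x\}$. For distinct paths $Q,R$ meeting at $x$ and $Q_a\in Q$, $Q(Q_a,R,x,\emptyset)=\{y: [x\;y\;Q_a]\text{ and there is } w\in R \text{ (}w\notin Q\text{) with } Q_a,y\in Q(w,\emptyset)\}$. $\mathrm{SPRAY}[x]$ is the set of paths containing the event $x$. Three distinct paths of $\mathrm{SPRAY}[x]$ are dependent if some path not in $\mathrm{SPRAY}[x]$ meets each of the three; then each is said to be dependent on the set of the other two. Inductively, a path $T$ is dependent on a set $S\subseteq\mathrm{SPRAY}[x]$ with $n\ge3$ elements if $T$ is dependent on a set of two paths $\{S_1,S_2\}$, each of which is dependent on some subset of $S$ with $n-1$ elements. A set of paths is dependent if it contains a path $P$ and a subset not containing $P$ on which $P$ is dependent (for some $x$); it is independent if it has no dependent subset. $\mathrm{SPRAY}[x]$ is a 3-SPRAY if it contains four distinct paths forming an independent set such that every path of $\mathrm{SPRAY}[x]$ is dependent on the set of these four. The following axioms are assumed. (I1) $\mathcal E\neq\emptyset$. (I2) For distinct events $a,b$ there are paths $R\ni a$, $S\ni b$ with $R\cap S\ne\emptyset$. (I3) For any two distinct events there is at most one path containing both. (I4) If $\mathcal E\ne\emptyset$, there is at least one 3-SPRAY. (O1) If $[a\;b\;c]$ then some path contains $a,b,c$. (O2) $[a\;b\;c]\Rightarrow[c\;b\;a]$. (O3) $[a\;b\;c]\Rightarrow a\neq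 c$. (O4) $[a\;b\;c]$ and $[b\;c\;d]$ imply $[a\;b\;d]$ (no distinctness of $a,d$ is assumed). (O5) If $a,b,c$ are distinct events of one path, then $[a\;b\;c]$ or $[b\;c\;a]$ or $[c\;a\;b]$. (O6) If $Q,R,S$ are distinct paths, $T$ is a path, $a\in Q\cap R$, $b\in Q\cap S$, $c\in R\cap S$, and there are $d\in S$ with $[b\;c\;d]$ and $e\in R$ with $[c\;e\;a]$ and $d,e\in T$, then there is $f\in T\cap Q$ belonging to a finite chain with first event $a$ and last event $b$, where $a,f,b$ are distinct. (I5) For any path $Q$ and event $b\notin Q$, the set $Q(b,\emptyset)$ contains at least two events. (I6) For any path $Q$, event $b\notin Q$ and distinct $Q_x,Q_z\in Q(b,\emptyset)$ there is a finite chain $(q_0,\dots,q_n)$ with $q_0=Q_x$, $q_n=Q_z$ such that for all $i\in\{1,\dots,n\}$: $q_i\in Q(b,\emptyset)$, and every event $y$ with $[q_{i-1}\;y\;q_i]$ lies in $Q(b,\emptyset)$. (I7) For any path $Q$, event $b\notin Q$, $Q_x\in Q\setminus Q(b,\emptyset)$ and $Q_y\in Q(b,\emptyset)$ there is a finite chain $(q_0,\dots,q_n)$ and $0<m<n$ with $q_0=Q_x$, $q_m=Q_y$ and $q_n\in Q\setminus Q(b,\emptyset)$. (S) If $Q,R,S$ are distinct paths with $x\in Q\cap R\cap S$, and $Q_a\in Q\setminus\{x\}$ satisfies $Q(Q_a,R,x,\emptyset)=Q(Q_a,S,x,\emptyset)$, then there is a map $\theta:\mathcal E\to\mathcal E$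 such that $P\mapsto\theta(P)$ (direct image) is a bijection $\mathcal P\to\mathcal P$, $\theta(y)=y$ for all $y\in Q$, and $\theta(R)=S$. (C) Every infinite chain that has a bound has a closest bound. *)

(* Defs.v *)
From mathcomp Require Import all_boot.
From mathcomp Require Import boolp classical_sets functions cardinality.

Set Implicit Arguments.
Unset Strict Implicit.
Unset Printing Implicit Defensive.

Local Open Scope classical_set_scope.
Local Open Scope card_scope.

Record spacetime := Spacetime {
  event :> Type;
  paths : set (set event);
  btw : event -> event -> event -> Prop }.

Arguments paths {M} _ : rename.
Arguments btw {M} _ _ _ : rename.

Definition btw_set (M : spacetime) (y : M) (A : set M) (z : M) : Prop :=
  forall x, A x -> btw y x z.

Definition can_join (M : spacetime) (a : M) (Q : set M) : Prop :=
  exists R : set M, [/\ paths R, R a & R `&` Q !=set0].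

Definition path_joining (M : spacetime) (a e : M) : Prop :=
  a <> e /\ exists R : set M, [/\ paths R, R a & R e].

(* The chain is (q 0, ..., q n); the values of q beyond n are irrelevant. *)
Definition finite_chain (M : spacetime) (n : nat) (q : nat -> M) : Prop :=
  [/\ 1 <= n,
      n = 1 -> path_joining (q 0) (q 1)
    & 2 <= n -> forall i j k : nat, i < j -> j < k -> k <= n ->
        btw (q i) (q j) (q k)].

Definition infinite_chain (M : spacetime) (q : nat -> M) : Prop :=
  forall i j k : nat, i < j -> j < k -> btw (q i) (q j) (q k).

Definition bound (M : spacetime) (q : nat -> M) (p : M) : Prop :=
  forall i j : nat, i < j -> btw (q i) (q j) p.

Definition closest_bound (M : spacetime) (q : nat -> M) (p : M) : Prop :=
  bound q p /\ forall p', bound q p' -> p' <> p -> btw (q 0) p p'.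

(* The unreachable subset of Q from b, written Q(b, ∅); b is meant to lie off Q. *)
Definition unreach (M : spacetime) (Q : set M) (b : M) : set M :=
  [set x | Q x /\ ~ exists R : set M, [/\ paths R, R b & R x]].

(* The unreachable subset of Q from Qa via R, written Q(Qa, R, x, ∅); Q and R
   are meant to be distinct paths meeting at x. *)
Definition unreach_via (M : spacetime) (Q : set M) (Qa : M) (R : set M)
    (x : M) : set M :=
  [set y | btw x y Qa /\
     exists w, [/\ R w, ~ Q w, unreach Q w Qa & unreach Q w y]].

Definition distinct3 (T : Type) (a b c : T) : Prop :=
  [/\ a <> b, b <> c & a <> c].

Definition SPRAY (M : spacetime) (x : M) : set (set M) :=
  [set P | paths P /\ P x].

Definition dependent3 (M : spacetime) (x : M) (P Q R : set M) : Prop :=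
  [/\ distinct3 P Q R, SPRAY x P, SPRAY x Q, SPRAY x R
    & exists T : set M, [/\ paths T, ~ SPRAY x T, T `&` P !=set0,
        T `&` Q !=set0 & T `&` R !=set0]].

(* dependent_on x T S: the path T is dependent on S, a subset of SPRAY x; in
   the inductive clause S has n.+3 elements. *)
Inductive dependent_on (M : spacetime) (x : M) :
    set M -> set (set M) -> Prop :=
| dependent_on_pair (T S1 S2 : set M) :
    dependent3 x T S1 S2 -> dependent_on x T [set S1; S2]
| dependent_on_more (n : nat) (T S1 S2 : set M) (S A1 A2 : set (set M)) :
    S `<=` SPRAY x -> S #= `I_n.+3 -> dependent3 x T S1 S2 ->
    A1 `<=` S -> A1 #= `I_n.+2 -> dependent_on x S1 A1 ->
    A2 `<=` S -> A2 #= `I_n.+2 -> dependent_on x S2 A2 ->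
    dependent_on x T S.

Definition dependent_set (M : spacetime) (D : set (set M)) : Prop :=
  exists (x : M) (P : set M) (S : set (set M)),
    [/\ D P, S `<=` D, ~ S P & dependent_on x P S].

Definition independent_set (M : spacetime) (D : set (set M)) : Prop :=
  forall D' : set (set M), D' `<=` D -> ~ dependent_set D'.

Definition three_SPRAY (M : spacetime) (x : M) : Prop :=
  exists F : set (set M),
    [/\ F `<=` SPRAY x, F #= `I_4, independent_set F
      & forall P, SPRAY x P -> dependent_on x P F].

Record spacetime_axioms (M : spacetime) : Prop := SpacetimeAxioms {
  axiom_I1 : [set: M] !=set0;
  axiom_I2 : forall a b : M, a <> b -> exists R S : set M,
    [/\ paths R, paths S, R a, S b & R `&` S !=set0];
  axiom_I3 : forall (a b : M) (P Q : set M), a <> b ->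
    paths P -> P a -> P b -> paths Q -> Q a -> Q b -> P = Q;
  axiom_I4 : [set: M] !=set0 -> exists x : M, three_SPRAY x;
  axiom_O1 : forall a b c : M, btw a b c ->
    exists P : set M, [/\ paths P, P a, P b & P c];
  axiom_O2 : forall a b c : M, btw a b c -> btw c b a;
  axiom_O3 : forall a b c : M, btw a b c -> a <> c;
  axiom_O4 : forall a b c d : M, btw a b c -> btw b c d -> btw a b d;
  axiom_O5 : forall (P : set M) (a b c : M), paths P -> P a -> P b -> P c ->
    distinct3 a b c -> [\/ btw a b c, btw b c a | btw c a b];
  axiom_O6 : forall (Q R S T : set M) (a b c d e : M),
    paths Q -> paths R -> paths S -> distinct3 Q R S -> paths T ->
    (Q `&` R) a -> (Q `&` S) b -> (R `&` S) c ->
    S d -> btw b c d -> R e -> btw c e a -> T d -> T e ->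
    exists f, [/\ (T `&` Q) f, distinct3 a f b
      & exists (n : nat) (q : nat -> M), [/\ finite_chain n q, q 0 = a, q n = b
          & exists2 i : nat, i <= n & q i = f]];
  axiom_I5 : forall (Q : set M) (b : M), paths Q -> ~ Q b ->
    exists u v : M, [/\ u <> v, unreach Q b u & unreach Q b v];
  axiom_I6 : forall (Q : set M) (b Qx Qz : M), paths Q -> ~ Q b ->
    unreach Q b Qx -> unreach Q b Qz -> Qx <> Qz ->
    exists (n : nat) (q : nat -> M), [/\ finite_chain n q, q 0 = Qx, q n = Qz
      & forall i : nat, 1 <= i <= n -> unreach Q b (q i) /\
          forall y, btw (q i.-1) y (q i) -> unreach Q b y];
  axiom_I7 : forall (Q : set M) (b Qx Qy : M), paths Q -> ~ Q b ->
    (Q `\` unreach Q b) Qx -> unreach Q b Qy ->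
    exists (n m : nat) (q : nat -> M), [/\ finite_chain n q, 0 < m < n,
      q 0 = Qx, q m = Qy & (Q `\` unreach Q b) (q n)];
  axiom_S : forall (Q R S : set M) (x Qa : M),
    paths Q -> paths R -> paths S -> distinct3 Q R S ->
    (Q `&` R `&` S) x -> Q Qa -> Qa <> x ->
    unreach_via Q Qa R x = unreach_via Q Qa S x ->
    exists theta : M -> M,
      [/\ set_bij paths paths (fun P : set M => theta @` P),
          forall y, Q y -> theta y = y & theta @` R = S];
  axiom_C : forall q : nat -> M, infinite_chain q ->
    (exists p, bound q p) -> exists p, closest_bound q p }.

(* Main.v *)
(* The hull of finitely many events on a path needs the full theory of a linear
   order, which (O1)-(O5) alone do not give: they allow an event b lying between
   any two of three events a, c, d (a "star").  Stars are excluded by (O6).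
   Joinability is obtained by pushing the leaves of a star away from b along
   their path with (I7), which preserves the star; the middle leaf a is then
   joined to some e on a second path through b, the others to some g beyond e,
   and by (O6) the path ae crosses all three sides of the triangle formed by g
   and the outer leaves, which is impossible.  With the order in hand, (I6) shows
   that unreachable subsets are convex, (I7) that they are bounded, and a
   common hull followed by prolongation gives the three claims. *)

Require Import Defs.
From mathcomp Require Import all_boot.
From mathcomp Require Import boolp classical_sets functions cardinality.

Local Open Scope classical_set_scope.

Section Order.

Set Implicit Arguments.
Unset Strict Implicit.

Context {M : spacetime} (ax : spacetime_axioms M).
Implicit Types (a b c d e u v x y z : M) (P Q R S T : set M).

(** * Betweenness along a path *)

(** The relation negated in [unreach]; unlike [path_joining] it admits [u = v]. *)
Definition joined u v : Prop := exists R, [/\ paths R, R u & R v].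

Definition btw_closed a x b : Prop := [\/ x = a, x = b | btw a x b].

Lemma btw_sym a b c : btw a b c -> btw c b a.
Proof. exact: (axiom_O2 ax). Qed.

Lemma btw_trans a b c d : btw a b c -> btw b c d -> btw a b d.
Proof. exact: (axiom_O4 ax). Qed.

Lemma btw_neq13 a b c : btw a b c -> a <> c.
Proof. exact: (axiom_O3 ax). Qed.

(** With [a = b], (O4) turns [c a a] and [a a c] into [c a c], against (O3). *)
Lemma btw_neq12 a b c : btw a b c -> a <> b.
Proof.
move=> h ab; rewrite -ab in h.
by apply: (btw_neq13 (btw_trans (btw_sym h) h)).
Qed.

Lemma btw_neq23 a b c : btw a b c -> b <> c.
Proof. by move=> /btw_sym/btw_neq12 h bc; apply: h. Qed.

Lemma btw_cycle a b c : btw a b c -> ~ btw b c a.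
Proof. by move=> h1 h2; apply: (btw_neq13 (btw_trans h1 h2)). Qed.

Lemma btw_swap a b c : btw a b c -> ~ btw a c b.
Proof. by move=> h1 /btw_sym h2; apply: (btw_cycle h1). Qed.

Lemma path_eq P Q a b : paths P -> paths Q ->
  P a -> P b -> Q a -> Q b -> a <> b -> P = Q.
Proof. by move=> *; apply: (axiom_I3 ax (a := a) (b := b)). Qed.

Lemma meet_uniq P Q a b : paths P -> paths Q -> P <> Q ->
  P a -> P b -> Q a -> Q b -> a = b.
Proof.
by move=> pP pQ PQ *; apply: contrapT => ab; apply: PQ; apply: (@path_eq P Q a b).
Qed.

Lemma btw_path13 Q a b c : paths Q -> btw a b c -> Q a -> Q c -> Q b.
Proof.
move=> pQ h Qa Qc; have [P [pP Pa Pb Pc]] := axiom_O1 ax h.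
by rewrite -(path_eq pP pQ Pa Pc Qa Qc (btw_neq13 h)).
Qed.

Lemma btw_path12 Q a b c : paths Q -> btw a b c -> Q a -> Q b -> Q c.
Proof.
move=> pQ h Qa Qb; have [P [pP Pa Pb Pc]] := axiom_O1 ax h.
by rewrite -(path_eq pP pQ Pa Pb Qa Qb (btw_neq12 h)).
Qed.

Lemma btw_total Q a b c : paths Q -> Q a -> Q b -> Q c ->
  a <> b -> b <> c -> a <> c -> [\/ btw a b c, btw b c a | btw c a b].
Proof. by move=> *; apply: (axiom_O5 ax (P := Q)). Qed.

(** Obtained without (O6); the companion conclusion [b c d] has to wait for [no_star]. *)
Lemma btw_inner_trans a b c d : btw a b c -> btw a c d -> btw a b d.
Proof.
move=> abc acd; have [P [pP Pa Pb Pc]] := axiom_O1 ax abc.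
have Pd := btw_path12 pP acd Pa Pc.
have bd : b <> d by move=> bd; rewrite -bd in acd; apply: (btw_swap abc).
have [//|bda|dab] := btw_total pP Pa Pb Pd (btw_neq12 abc) bd (btw_neq13 acd).
- have [bcd|cdb|dbc] := btw_total pP Pb Pc Pd (btw_neq23 abc) (btw_neq23 acd) bd.
  + exact: btw_trans abc bcd.
  + by case: (btw_swap abc (btw_trans acd cdb)).
  + by case: (btw_swap acd (btw_trans (btw_sym bda) dbc)).
- by case: (btw_swap (btw_sym acd) (btw_trans dab abc)).
Qed.

(** * Finite chains and the Pasch property *)

Lemma finite_chain_btw n q i j k : @finite_chain M n q ->
  i < j -> j < k -> k <= n -> btw (q i) (q j) (q k).
Proof.
move=> [_ _ h] ij jk kn; apply: h => //.
by apply: leq_trans kn; apply: leq_trans jk; rewrite ltnS; apply: leq_ltn_trans ij.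
Qed.

(** (O6) only puts [f] on a finite chain from [a] to [b]; being distinct from both, [f] has an
    interior index, whence [a f b]. *)
Lemma pasch Q R S T a b c d e :
  paths Q -> paths R -> paths S -> distinct3 Q R S -> paths T ->
  Q a -> R a -> Q b -> S b -> R c -> S c ->
  btw b c d -> btw c e a -> T d -> T e ->
  exists f, [/\ T f, Q f & btw a f b].
Proof.
move=> pQ pR pS QRS pT Qa Ra Qb Sb Rc Sc bcd cea Td Te.
have Sd := btw_path12 pS bcd Sb Sc; have Re := btw_path13 pR cea Rc Ra.
have [f [[Tf Qf] [af fb _] [n [q [cq q0 qn [i le_in qi]]]]]] :=
  @axiom_O6 M ax Q R S T a b c d e pQ pR pS QRS pT (conj Qa Ra) (conj Qb Sb)
    (conj Rc Sc) Sd bcd Re cea Td Te.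
exists f; split=> //; rewrite -q0 -qn -qi; apply: (finite_chain_btw cq) => //.
- by rewrite lt0n; apply/eqP => i0; apply: af; rewrite -q0 -qi i0.
- by rewrite ltn_neqAle le_in andbT; apply/eqP => i_n; apply: fb; rewrite -qn -qi i_n.
Qed.

(** * Reachability, crossing paths and prolongation *)

Lemma joined_sym u v : joined u v -> joined v u.
Proof. by move=> [R [pR Ru Rv]]; exists R. Qed.

Lemma joinedNunreach Q b x : Q x -> ~ unreach Q b x -> joined b x.
Proof. by move=> Qx h; apply: contrapT => nj; apply: h. Qed.

(** The chain of (I7) from [x] through [y] ends at an event outside the unreachable subset; that end
    is [z]. *)
Lemma joined_beyond Q b x y : paths Q -> ~ Q b -> Q x -> joined b x ->
  unreach Q b y -> exists z, [/\ btw x y z, Q z & joined b z].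
Proof.
move=> pQ nQb Qx jbx ub.
have Dx : (Q `\` unreach Q b) x by split=> // -[_ /(_ jbx)].
have [n [m [q [cq /andP[m0 mn] q0 qm [Qqn nqn]]]]] := axiom_I7 ax pQ nQb Dx ub.
exists (q n); split=> //; last exact: joinedNunreach nqn.
by rewrite -q0 -qm; apply: (finite_chain_btw cq).
Qed.

Lemma unreach_neq Q b x : paths Q -> ~ Q b ->
  exists2 y, unreach Q b y & y <> x.
Proof.
move=> pQ nQb; have [u [v [uv hu hv]]] := axiom_I5 ax pQ nQb.
case: (pselect (u = x)) => [ux|ux]; last by exists u.
by exists v => // vx; apply: uv; rewrite ux vx.
Qed.

(** Two of the four independent paths of a 3-SPRAY are distinct, so one of them differs from [Q]. *)
Lemma two_paths_event : exists x, forall Q, exists P, [/\ paths P, P x & P <> Q].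
Proof.
have [x [F [Fx F4 _ _]]] := axiom_I4 ax (axiom_I1 ax).
exists x => Q; move: F4; rewrite card_eq_sym => /card_set_bijP[f [fF finj _]].
have F0 : F (f 0) by apply: fF.
have F1 : F (f 1) by apply: fF.
case: (pselect (f 0 = Q)) => [f0Q|f0Q]; last first.
  by exists (f 0); split=> //; case: (Fx _ F0).
exists (f 1); split; [by case: (Fx _ F1)|by case: (Fx _ F1)|move=> f1Q].
suff : 0 = 1 by [].
by apply: finj; rewrite ?inE //= f0Q f1Q.
Qed.

(* If Q were the only path through b, any S <> Q meeting Q at y <> b would have,
   by (I7), an event other than y joined to b, hence on Q. *)
Lemma crossing_path Q b : paths Q -> Q b -> exists S, [/\ paths S, S b & S <> Q].
Proof.
move=> pQ Qb; apply: contrapT => nS.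
have only R : paths R -> R b -> R = Q.
  by move=> pR Rb; apply: contrapT => RQ; apply: nS; exists R.
have [x hx] := two_paths_event.
have [S [y [pS SQ Sy Qy]]] : exists S y, [/\ paths S, S <> Q, S y & Q y].
  have [P [pP Px PQ]] := hx Q.
  case: (pselect (Q x)) => Qx; first by exists P, x.
  have bx : b <> x by move=> bx; apply: Qx; rewrite -bx.
  (* The path [R] of (I2) passes through [b], so it can only be [Q]; hence [S] meets [Q]. *)
  have [R [S [pR pS Rb Sx [y [Ry Sy]]]]] := axiom_I2 ax bx.
  exists S, y; split=> //; first by move=> SQ; apply: Qx; rewrite -SQ.
  by rewrite -(only _ pR Rb).
have nSb : ~ S b by move=> Sb; apply: SQ; apply: only.
have [w uw wy] := unreach_neq y pS nSb.
have jby : joined b y by exists Q.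
have [z [ywz Sz [R [pR Rb Rz]]]] := joined_beyond pS nSb Sy jby uw.
apply: (btw_neq13 ywz); apply: (@meet_uniq S Q) => //.
by rewrite -(only _ pR Rb).
Qed.

Lemma prolong Q a b : paths Q -> Q a -> Q b -> a <> b -> exists c, btw a b c.
Proof.
move=> pQ Qa Qb ab; have [S [pS Sa SQ]] := crossing_path pQ Qa.
have nSb : ~ S b by move=> Sb; apply: SQ; apply: (@path_eq S Q a b).
(* Unreachability is symmetric: [b] is out of reach of such an [f], while [a] is joined to [f] along
   [S]. *)
have [f uf fa] := unreach_neq a pS nSb.
(* b is unreachable from f, so (I7) for Q and f gives an event beyond b. *)
have nQf : ~ Q f by move=> Qf; apply: fa; case: uf => Sf _; apply: (@meet_uniq S Q).
have jfa : joined f a by exists S; split=> //; case: uf.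
have ufb : unreach Q f b by split=> // /joined_sym jbf; case: uf.
by have [c [abc _ _]] := joined_beyond pQ nQf Qa jfa ufb; exists c.
Qed.

(** * No path crosses all three sides of a triangle *)

(* (O6) applied to the triangle y x' z', with the path Y through z and y', puts x
   between z' and y. *)
Lemma no_transversal_ordered X Y Z T x y z x' y' z' :
  paths X -> paths Y -> paths Z -> distinct3 X Y Z -> paths T ->
  X y -> X z -> Y x -> Y z -> Z x -> Z y ->
  btw y x' z -> btw z y' x -> btw x z' y ->
  T x' -> T y' -> T z' -> ~ btw x' y' z'.
Proof.
move=> pX pY pZ [XY YZ XZ] pT Xy Xz Yx Yz Zx Zy hx hy hz Tx Ty Tz h.
have Xx' := btw_path13 pX hx Xy Xz; have Yy' := btw_path13 pY hy Yz Yx.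
have Zz' := btw_path13 pZ hz Zx Zy.
have nTy : ~ T y.
  move=> Ty0; have TX : T = X.
    by apply: (@path_eq T X x' y) => //; apply/nesym/(btw_neq12 hx).
  have TZ : T = Z by apply: (@path_eq T Z z' y) => //; apply: (btw_neq23 hz).
  by apply: XZ; rewrite -TX TZ.
have dZTX : distinct3 Z T X.
  split; [move=> E|move=> E|by move/esym].
  - by apply: nTy; rewrite -E.
  - by apply: nTy; rewrite E.
have [f [Yf Zf zfy]] := pasch pZ pT pX dZTX pY Zz' Tz Zy Xy Tx Xx' hx h Yz Yy'.
have fx : f = x by apply: (@meet_uniq Y Z).
by rewrite fx in zfy; apply: (btw_swap (btw_sym hz)); exact: btw_sym.
Qed.

(** A prime marks the crossing opposite the vertex of that name. The configuration is invariant
    under cyclic relabelling, so [no_transversal_ordered] applies whichever crossing (O5) puts in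
    the middle. *)
Lemma no_transversal X Y Z T x y z x' y' z' :
  paths X -> paths Y -> paths Z -> distinct3 X Y Z -> paths T ->
  X y -> X z -> Y x -> Y z -> Z x -> Z y ->
  btw y x' z -> btw z y' x -> btw x z' y ->
  T x' -> T y' -> ~ T z'.
Proof.
move=> pX pY pZ [XY YZ XZ] pT Xy Xz Yx Yz Zx Zy hx hy hz Tx Ty Tz.
have Xx' := btw_path13 pX hx Xy Xz; have Yy' := btw_path13 pY hy Yz Yx.
have Zz' := btw_path13 pZ hz Zx Zy.
have nxy : x' <> y'.
  move=> E; apply: (btw_neq23 hx); apply: (@meet_uniq X Y) => //; by rewrite E.
have nyz : y' <> z'.
  move=> E; apply: (btw_neq23 hy); apply: (@meet_uniq Y Z) => //; by rewrite E.
have nxz : x' <> z'.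
  move=> E; apply: (btw_neq12 hx); apply: (@meet_uniq X Z) => //; by rewrite E.
have [h|h|h] := btw_total pT Tx Ty Tz nxy nyz nxz.
- by apply: (@no_transversal_ordered X Y Z T x y z x' y' z').
- by apply: (@no_transversal_ordered Y Z X T y z x y' z' x') => //; split=> //; apply/nesym.
- by apply: (@no_transversal_ordered Z X Y T z x y z' x' y') => //; split=> //; apply/nesym.
Qed.

(** * Exclusion of stars *)

Definition star b a c d : Prop := [/\ btw a b c, btw a b d & btw c b d].

Definition star_ext b l l' : Prop := l' = l \/ btw b l l'.

Lemma btw_ext a b c c' : btw a b c -> star_ext b c c' -> btw a b c'.
Proof. by move=> abc [->|bcc'] //; apply: btw_trans abc bcc'. Qed.

(** Each leaf is an end in two of the three relations, and (O4) lets an end move away from [b]. *)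
Lemma star_extend b a c d a' c' d' : star b a c d ->
  star_ext b a a' -> star_ext b c c' -> star_ext b d d' -> star b a' c' d'.
Proof.
move=> [abc abd cbd] ea ec ed; split.
- by apply: btw_ext ec; apply/btw_sym; apply: btw_ext ea; apply/btw_sym.
- by apply: btw_ext ed; apply/btw_sym; apply: btw_ext ea; apply/btw_sym.
- by apply: btw_ext ed; apply/btw_sym; apply: btw_ext ec; apply/btw_sym.
Qed.

(** From [c' c b] and [c b a] comes [a c c'], which (O4) appends to [d a c]. *)
Lemma star_middle_extend b a c d c' : star b a c d -> btw c a d ->
  star_ext b c c' -> btw c' a d.
Proof.
move=> [abc abd cbd] cad [->//|bcc'].
have acc' := btw_sym (btw_trans (btw_sym bcc') (btw_sym abc)).
exact: btw_sym (btw_trans (btw_sym cad) acc').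
Qed.

Lemma joined_extend Q b e l : paths Q -> ~ Q e -> Q b -> joined e b -> Q l ->
  exists l', [/\ Q l', joined e l' & star_ext b l l'].
Proof.
move=> pQ nQe Qb jeb Ql; case: (pselect (joined e l)) => jel.
  by exists l; split=> //; left.
have [l' [bll' Ql' jel']] := joined_beyond pQ nQe Qb jeb (conj Ql jel).
by exists l'; split=> //; right.
Qed.

Lemma star_middle_false Q S b a c d e : paths Q -> paths S -> S <> Q ->
  Q a -> Q b -> Q c -> Q d -> S b -> S e -> e <> b -> joined e a ->
  star b a c d -> ~ btw c a d.
Proof.
move=> pQ pS SQ Qa Qb Qc Qd Sb Se eb [T [pT Te Ta]] st cad.
have [g beg] := prolong pS Sb Se (nesym eb).
have Sg := btw_path12 pS beg Sb Se.
have nQS x : Q x -> S x -> x = b by move=> Qx Sx; apply: (@meet_uniq S Q).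
have nQg : ~ Q g by move=> /nQS/(_ Sg)/esym/(btw_neq13 beg).
have jgb : joined g b by exists S.
have [c' [Qc' [C [pC Cg Cc]] ec]] := joined_extend pQ nQg Qb jgb Qc.
have [d' [Qd' [D [pD Dg Dd]] ed]] := joined_extend pQ nQg Qb jgb Qd.
have st' := star_extend st (or_introl erefl) ec ed.
have cad' : btw c' a d'.
  apply: star_middle_extend ec => //.
    exact: star_extend st (or_introl erefl) (or_introl erefl) ed.
  apply/btw_sym; apply: star_middle_extend ed; last exact: btw_sym.
  by case: st => abc abd /btw_sym.
case: st' => abc abd cbd.
have dQ E l : paths E -> E g -> E l -> Q l -> btw a b l -> distinct3 E S Q.
  move=> pE Eg El Ql abl; split=> // EX.
    by apply: (btw_neq23 abl); apply/esym/nQS => //; rewrite -EX.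
  by apply: nQg; rewrite -EX.
(* In the triangle [g], [b], [c'] the path [T] meets the side [b g] at [e] and contains [a], beyond
   [b] from [c']; so it crosses the side [g c']. The same holds with [d'], and [a] itself is on the
   side [c' d']. *)
have [f [Tf Cf gfc]] := pasch pC pS pQ (dQ _ _ pC Cg Cc Qc' abc) pT
  Cg Sg Cc Qc' Sb Qb (btw_sym abc) beg Ta Te.
have [h [Th Dh ghd]] := pasch pD pS pQ (dQ _ _ pD Dg Dd Qd' abd) pT
  Dg Sg Dd Qd' Sb Qb (btw_sym abd) beg Ta Te.
have [CS _ CQ] := dQ _ _ pC Cg Cc Qc' abc.
have [DS _ DQ] := dQ _ _ pD Dg Dd Qd' abd.
apply: (@no_transversal Q D C T g c' d' a h f) => //; last exact: btw_sym.
split=> //; [by apply/nesym| |by apply/nesym].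
move=> DC; apply: DQ; apply: (@path_eq D Q c' d') => //; first by rewrite DC.
exact: btw_neq13 cbd.
Qed.

Lemma no_star b a c d : ~ star b a c d.
Proof.
move=> st; have [abc abd cbd] := st.
have [Q [pQ Qa Qb Qc]] := axiom_O1 ax abc; have Qd := btw_path12 pQ abd Qa Qb.
have [S [pS Sb SQ]] := crossing_path pQ Qb.
have nSa : ~ S a.
  by move=> Sa; apply: (btw_neq12 abc); apply: (@meet_uniq S Q).
(* (I5) for [S] and [a] is the source of an event of [S] other than [b]. *)
have [e [Se _] eb] := unreach_neq b pS nSa.
have nQe : ~ Q e by move=> Qe; apply: eb; apply: (@meet_uniq S Q).
have jeb : joined e b by exists S.
have [a' [Qa' ja ea]] := joined_extend pQ nQe Qb jeb Qa.
have [c' [Qc' jc ec]] := joined_extend pQ nQe Qb jeb Qc.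
have [d' [Qd' jd ed]] := joined_extend pQ nQe Qb jeb Qd.
have [acb adb cdb] := star_extend st ea ec ed.
(* All three leaves are now joined to [e], so any of them may turn out to be the middle one. *)
have [h|h|h] := btw_total pQ Qa' Qc' Qd' (btw_neq13 acb) (btw_neq13 cdb) (btw_neq13 adb).
- by apply: (@star_middle_false Q S b c' a' d' e) => //; split=> //; exact: btw_sym.
- apply: (@star_middle_false Q S b d' c' a' e) => //.
  by split=> //; exact: btw_sym.
- apply: (@star_middle_false Q S b a' d' c' e) => //.
  by split=> //; exact: btw_sym.
Qed.

(** * Linear order, and convexity and bounds of unreachable subsets *)

(** The case [d b c] of (O5) would make [b] the centre of a star with leaves [a], [c], [d]. *)
Lemma btw_inner_trans2 a b c d : btw a b c -> btw a c d -> btw b c d.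
Proof.
move=> abc acd; have abd := btw_inner_trans abc acd.
have [P [pP Pa Pb Pc]] := axiom_O1 ax abc; have Pd := btw_path12 pP acd Pa Pc.
have [//|cdb|dbc] :=
  btw_total pP Pb Pc Pd (btw_neq23 abc) (btw_neq23 acd) (btw_neq23 abd).
- by case: (btw_swap abc (btw_trans acd cdb)).
- by case: (@no_star b a c d); split=> //; apply: btw_sym.
Qed.

Lemma btw_split a b c d : btw a b d -> btw a c d -> b <> c ->
  btw a b c \/ btw a c b.
Proof.
move=> abd acd bc; have [P [pP Pa Pb Pd]] := axiom_O1 ax abd.
have Pc := btw_path13 pP acd Pa Pd.
have [abc|bca|cab] := btw_total pP Pa Pb Pc (btw_neq12 abd) bc (btw_neq12 acd).
- by left.
- by right; apply: btw_sym.
- by case: (btw_swap (btw_sym abd)(btw_sym (btw_trans (btw_sym cab) acd))).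
Qed.

Lemma unreach_convex Q b x y z : paths Q -> ~ Q b ->
  unreach Q b x -> unreach Q b z -> btw x y z -> unreach Q b y.
Proof.
move=> pQ nQb ux uz xyz.
have [n [q [cq q0 qn hq]]] := axiom_I6 ax pQ nQb ux uz (btw_neq13 xyz).
pose hit i := y = q i \/ btw x y (q i).
(* The first i with hit i locates y in the segment from q_(i-1) to q_i. *)
suff step i : i <= n -> hit i -> unreach Q b y.
  by apply: (step n) => //; right; rewrite qn.
elim: i => [|i IH] lein hi.
  by case: hi => [->|]; rewrite ?q0 // => /btw_neq13.
have [ui segi] := hq i.+1 (lein : 0 < i.+1 <= n).
case: (pselect (hit i)) => [|nhi]; first by apply: IH; apply: ltnW.
case: hi => [->//|xyi].
(* The first segment starts at [x] itself; for later ones the chain puts [x] before both ends of the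
   segment. *)
case: i => [|i] in IH lein ui segi nhi xyi *.
  by apply: segi; rewrite /= q0.
have xii : btw x (q i.+1) (q i.+2) by rewrite -q0; apply: (finite_chain_btw cq).
apply: segi => /=.
have ny : y <> q i.+1 by move=> E; apply: nhi; left.
case: (btw_split xyi xii ny) => [h|h]; first by case: nhi; right.
exact: btw_inner_trans2 h xyi.
Qed.

(** If an unreachable [u] were outside the segment, the joined end [x] or [z] would lie between [u]
    and [y], against convexity. *)
Lemma unreach_within Q b x y z : paths Q -> ~ Q b -> Q x -> Q z ->
  joined b x -> joined b z -> unreach Q b y -> btw x y z ->
  btw_set x (unreach Q b) z.
Proof.
move=> pQ nQb Qx Qz jx jz uy xyz u uu; have [Qu nju] := uu.
have ux : u <> x by move=> E; apply: nju; rewrite E.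
have zu : z <> u by move=> E; apply: nju; rewrite -E.
have [xzu|zux|uxz] := btw_total pQ Qx Qz Qu (btw_neq13 xyz) zu (nesym ux).
- have := unreach_convex pQ nQb uy uu (btw_inner_trans2 xyz xzu).
  by case=> _ /(_ jz).
- exact: btw_sym.
- have := unreach_convex pQ nQb uu uy
    (btw_sym (btw_inner_trans2 (btw_sym xyz) (btw_sym uxz))).
  by case=> _ /(_ jx).
Qed.

Lemma unreach_beyond Q b x : paths Q -> ~ Q b -> Q x -> joined b x ->
  exists z, [/\ Q z, x <> z & btw_set x (unreach Q b) z].
Proof.
move=> pQ nQb Qx jx.
have [_ [v [_ _ uv]]] := axiom_I5 ax pQ nQb.
have [z [xvz Qz jz]] := joined_beyond pQ nQb Qx jx uv.
exists z; split=> //; first exact: btw_neq13 xvz.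
exact: (@unreach_within Q b x v z).
Qed.

(** * Closed segments and hulls *)

Lemma closed_left a b : btw_closed a a b. Proof. by constructor 1. Qed.
Lemma closed_right a b : btw_closed a b b. Proof. by constructor 2. Qed.
#[local] Hint Resolve closed_left closed_right : core.

Lemma closed_sym a x b : btw_closed a x b -> btw_closed b x a.
Proof.
by case=> [->|->|/btw_sym]; [constructor 2|constructor 1|constructor 3].
Qed.

Lemma closed_btw s t p q u : btw_closed s p t -> btw_closed s q t ->
  btw p u q -> btw s u t.
Proof.
(* Up to exchanging [p] and [q], the one nearer to [s] comes first. *)
suff ordered p' q' : btw s p' q' -> btw_closed s q' t -> btw p' u q' -> btw s u t.
  case=> [->|->|spt]; case=> [->|->|sqt] // puq.
  - by case: (btw_neq13 puq).
  - exact: btw_inner_trans puq sqt.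
  - exact: btw_sym.
  - by case: (btw_neq13 puq).
  - apply/btw_sym; exact: btw_inner_trans puq (btw_sym sqt).
  - exact: btw_inner_trans (btw_sym puq) spt.
  - apply/btw_sym; exact: btw_inner_trans (btw_sym puq) (btw_sym spt).
  - have [h|h] := btw_split spt sqt (btw_neq13 puq).
    + by apply: ordered h _ puq; constructor 3.
    + by apply: ordered h _ (btw_sym puq); constructor 3.
move=> spq qt puq.
have suq : btw s u q'.
  by apply/btw_sym; apply: btw_inner_trans (btw_sym puq) (btw_sym spq).
case: qt => [E|<-//|sqt]; last exact: btw_inner_trans suq sqt.
by case: (btw_neq13 spq).
Qed.

Lemma closed_trans s t p q u : btw_closed s p t -> btw_closed s q t ->
  btw_closed p u q -> btw_closed s u t.
Proof.
move=> hp hq [->//|->//|puq]; constructor 3; exact: closed_btw puq.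
Qed.

Lemma hull Q p q r : paths Q -> Q p -> Q q -> Q r -> p <> q ->
  exists s t, [/\ Q s, Q t, s <> t, btw_closed s p t &
                  btw_closed s q t /\ btw_closed s r t].
Proof.
move=> pQ Qp Qq Qr pq.
case: (pselect (r = p)) => [->|rp]; first by exists p, q.
case: (pselect (r = q)) => [->|rq]; first by exists p, q.
have [h|h|h] := btw_total pQ Qp Qq Qr pq (nesym rq) (nesym rp).
- by exists p, r; do !split=> //; [apply/nesym|constructor 3].
- by exists p, q; do !split=> //; constructor 3; apply: btw_sym.
- by exists r, q; do !split=> //; constructor 3.
Qed.

Lemma common_hull Q p q p' q' : paths Q -> Q p -> Q q -> Q p' -> Q q' ->
  p <> q -> exists s t, [/\ Q s, Q t, s <> t,
    btw_closed s p t /\ btw_closed s q t &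
    btw_closed s p' t /\ btw_closed s q' t].
Proof.
move=> pQ Qp Qq Qp' Qq' pq.
have [s [t [Qs Qt st hp [hq hp']]]] := hull pQ Qp Qq Qp' pq.
have [s' [t' [Qs' Qt' st' hs [ht hq']]]] := hull pQ Qs Qt Qq' st.
by exists s', t'; do !split=> //; apply: closed_trans hs ht _.
Qed.

(** * The three claims *)

Lemma unreach_pair_within Q a b : paths Q -> ~ Q a -> can_join a Q ->
  ~ Q b -> can_join b Q -> exists y z,
    [/\ Q y, Q z, btw_set y (unreach Q a) z & btw_set y (unreach Q b) z].
Proof.
move=> pQ nQa [R [pR Ra [x [Rx Qx]]]] nQb [S [pS Sb [x' [Sx' Qx']]]].
have [z [Qz xz hz]] := unreach_beyond pQ nQa Qx (ex_intro _ R (And3 pR Ra Rx)).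
have [z' [Qz' xz' hz']] :=
  unreach_beyond pQ nQb Qx' (ex_intro _ S (And3 pS Sb Sx')).
have [s [t [Qs Qt st [hsx hsz] [hsx' hsz']]]] := common_hull pQ Qx Qz Qx' Qz' xz.
exists s, t; split=> // u hu.
- exact: closed_btw hsx hsz (hz u hu).
- exact: closed_btw hsx' hsz' (hz' u hu).
Qed.

(** A hull of [c], [d] and of a segment holding both unreachable subsets is prolonged past its end
    on the side of [d]; the new event is outside the hull, hence joined to [a] and [b]. *)
Lemma common_joined_beyond Q a b c d : paths Q -> ~ Q a -> can_join a Q ->
  ~ Q b -> can_join b Q -> Q c -> Q d -> c <> d ->
  exists e, [/\ Q e, path_joining a e, path_joining b e & btw c d e].
Proof.
move=> pQ nQa ja nQb jb Qc Qd cd.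
have [y [z [Qy Qz hya hyb]]] := unreach_pair_within pQ nQa ja nQb jb.
have [s [t [Qs Qt st [hc hd] [hy hz]]]] := common_hull pQ Qc Qd Qy Qz cd.
(* The ends [s], [t] come unoriented; [outer] takes them in the order that puts [t'] at [d] or
   beyond it from [c]. *)
suff outer s' t' : Q s' -> Q t' -> s' <> t' -> btw_closed s' c t' -> btw_closed s' y t' ->
    btw_closed s' z t' -> d = t' \/ btw c d t' ->
    exists e, [/\ Q e, path_joining a e, path_joining b e & btw c d e].
  have sc := closed_sym hc; have sd := closed_sym hd.
  have sy := closed_sym hy; have sz := closed_sym hz.
  case: (pselect (d = t)) => [dt|dt]; first by apply: (outer s t) => //; left.
  case: (pselect (d = s)) => [ds|ds].
    by apply: (outer t s) => //; [apply/nesym|left].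
  have sdt : btw s d t by case: hd.
  case: hc => [cs|ct|sct].
  - by apply: (outer s t) => //; [rewrite cs|rewrite cs; right].
  - by apply: (outer t s) => //; [apply/nesym|rewrite ct; right; apply: btw_sym].
  - have [scd|sdc] := btw_split sct sdt cd.
    + apply: (outer s t) => //; first by constructor 3.
      right; exact: btw_inner_trans2 scd sdt.
    + apply: (outer t s) => //; first by apply/nesym.
      by right; apply: btw_sym.
move=> {st hc hd hy hz} Qs' Qt' st hc hy hz hd.
have [e ste] := prolong pQ Qs' Qt' st; have Qe := btw_path12 pQ ste Qs' Qt'.
have nyez : ~ btw y e z.
  by move=> yez; apply: (btw_swap ste); apply: closed_btw yez.
have je v : ~ Q v -> btw_set y (unreach Q v) z -> path_joining v e.
  move=> nQv hv; split; first by move=> ve; apply: nQv; rewrite ve.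
  by apply: (joinedNunreach Qe) => ue; apply: nyez; apply: hv.
exists e; split; [by []|exact: je|exact: je|].
have cte : c <> t' -> btw c t' e.
  case: hc => [->//|//|sct _]; exact: btw_inner_trans2 sct ste.
case: hd => [dt|cdt]; first by rewrite dt; apply: cte; rewrite -dt.
exact: btw_inner_trans cdt (cte (btw_neq13 cdt)).
Qed.

End Order.

Theorem theorem14 (M : spacetime) (ax : spacetime_axioms M) :
  [/\ forall (Q : set M) (a b : M), paths Q ->
        ~ Q a -> can_join a Q -> ~ Q b -> can_join b Q ->
        exists y z : M, [/\ Q y, Q z,
          btw_set y (unreach Q a) z & btw_set y (unreach Q b) z],
      forall (Q : set M) (a b c d : M), paths Q ->
        ~ Q a -> can_join a Q -> ~ Q b -> can_join b Q ->
        Q c -> Q d -> c <> d ->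
        exists e : M, [/\ Q e, path_joining a e, path_joining b e & btw c d e]
    & forall (Q R : set M) (x a b : M), paths Q -> paths R -> Q <> R ->
        Q x -> R x -> R a -> a <> x -> ~ Q b -> can_join b Q ->
        exists e : M, [/\ path_joining a e, path_joining b e
          & btw_set x (unreach Q a) e]].
Proof.
split=> [Q a b|Q a b c d|Q R x a b pQ pR QR Qx Rx Ra ax_neq nQb jb].
- exact: unreach_pair_within.
- exact: common_joined_beyond.
have nQa : ~ Q a by move=> Qa; apply: ax_neq; apply: (@meet_uniq _ ax Q R).
have [z [Qz xz hz]] :=
  unreach_beyond ax pQ nQa Qx (ex_intro _ R (And3 pR Ra Rx)).
have ja : can_join a Q by exists R; split=> //; exists x.
(* The second claim for [x] and [z] gives [e] beyond [z], so each [x u z] extends to [x u e]. *)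
have [e [_ jae jbe xze]] := common_joined_beyond ax pQ nQa ja nQb jb Qx Qz xz.
exists e; split=> // u hu; have xuz := hz u hu.
exact: (btw_inner_trans ax xuz xze).
Qed.
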